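(* Let $f_1,\dots,f_n:\mathbb{R}^d\to\mathbb{R}$ be convex, each $f_i$ being $L_i$-smooth with minimizer $x_i$. Let $\alpha_i\in(0,1)$, $T_i(x) = \alpha_ix+(1-\alpha_i)x_i$, $\tilde f(x)=\frac{1}{n}\sum_if_i(T_i(x))$, let $x^*$ be a minimizer of $\tilde f$, and $L_\alpha=\frac{1}{n}\sum_i\alpha_i^2L_i$. Let $\omega_i\ge0$ and consider distributed compressed gradient descent on $\tilde f$: $x^{k+1} = x^k - \gamma\frac{1}{n}\sum_{i=1}^n\mathcal{C}_i^k(\alpha_i\nabla f_i(T_i(x^k)))$, with $\mathcal{C}_i^k\in\mathbb{B}^d(\omega_i)$ drawn independently across $i$ and $k$. If $0<\gamma\leq\frac{1}{4\left(L_\alpha + \frac{2\max_i\{L_i\omega_i\alpha_i^2\}}{n}\right)}$, then \[ \mathbb{E}[\tilde f(\overline{x}^k) - \tilde f(x^* )]\leq\frac{2(\tilde f(x^0)-\tilde f(x^* ))}{k} + \frac{\|x^0-x^*\|^2}{\gamma k} + 2\gamma\sigma_{DCGD}, \] where $\overline{x}^k = \frac{1}{k}\sum_{j=1}^k x^j$ and $\sigma_{DCGD} = \frac{2}{n^2}\sum_{i=1}^n\omega_i\alpha_i^2\|\nabla f_i(T_i(x^* ))\|^2$.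
   Context: A (random) operator $\mathcal{C}$ belongs to $\mathbb{B}^d(\omega)$ if $\mathbb{E}[\mathcal{C}(x)] = x$ and $\mathbb{E}\|\mathcal{C}(x)-x\|^2\leq\omega\|x\|^2$ for all $x$. A differentiable $g$ is $L$-smooth if $\|\nabla g(x)-\nabla g(y)\|\leq L\|x-y\|$ for all $x,y$. *)

(* Defs.v *)
From HB Require Import structures.
From mathcomp Require Import all_boot all_order all_algebra.
From mathcomp Require Import all_classical all_reals all_analysis.
Set Implicit Arguments. Unset Strict Implicit. Unset Printing Implicit Defensive.
Import Order.TTheory GRing.Theory Num.Theory.
Import numFieldNormedType.Exports.
Local Open Scope classical_set_scope.
Local Open Scope ring_scope.

Section Defs.
Context {R : realType} {d : nat}.

Definition dotv (x y : 'rV[R]_d) : R := \sum_(j < d) x ord0 j * y ord0 j.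
Definition sqnorm (x : 'rV[R]_d) : R := dotv x x.
Definition enorm (x : 'rV[R]_d) : R := Num.sqrt (sqnorm x).

Definition convex_fun (f : 'rV[R]_d -> R) : Prop :=
  forall (x y : 'rV[R]_d) (t : R), 0 <= t <= 1 ->
    f (t *: x + (1 - t) *: y) <= t * f x + (1 - t) * f y.

Definition is_gradient (f : 'rV[R]_d -> R) (g : 'rV[R]_d -> 'rV[R]_d) : Prop :=
  forall x : 'rV[R]_d, differentiable f x /\ forall v, 'd f x v = dotv (g x) v.

Definition L_smooth (f : 'rV[R]_d -> R) (g : 'rV[R]_d -> 'rV[R]_d) (L : R) : Prop :=
  is_gradient f g /\ forall x y, enorm (g x - g y) <= L * enorm (x - y).

Definition is_minimizer (f : 'rV[R]_d -> R) (x : 'rV[R]_d) : Prop :=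
  forall y, f x <= f y.

Definition borel_rV : set (set 'rV[R]_d) := <<s open >>.
Definition prod_sigma {dS : measure_display} (S : measurableType dS) : set (set (S * 'rV[R]_d)) :=
  <<s [set AB | exists (A : set S) (B : set 'rV[R]_d),
        measurable A /\ borel_rV B /\ AB = A `*` B] >>.

(* A random operator given by a random "seed" w |-> xi w in a measurable
   space S and a jointly measurable map c : S -> R^d -> R^d:
   C(w)(x) = c (xi w) x. *)
Definition jointly_measurable {dS} {S : measurableType dS}
    (c : S -> 'rV[R]_d -> 'rV[R]_d) : Prop :=
  forall (j : 'I_d) (B : set R), measurable B ->
    @prod_sigma dS S ((fun p : S * 'rV[R]_d => c p.1 p.2 ord0 j) @^-1` B).

Definition in_Bd {dO} {Om : measurableType dO} (P : probability Om R)
    (C : Om -> 'rV[R]_d -> 'rV[R]_d) (om : R) : Prop :=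
  forall x : 'rV[R]_d,
    (forall j : 'I_d, P.-integrable setT (fun w => ((C w x) ord0 j)%:E)) /\
    (forall j : 'I_d, (\int[P]_w ((C w x) ord0 j)%:E = (x ord0 j)%:E)%E) /\
    (\int[P]_w (sqnorm (C w x - x))%:E <= (om * sqnorm x)%:E)%E.

End Defs.

Definition mutually_independent {R : realType} {dO} {Om : measurableType dO}
    (P : probability Om R) {I : eqType} {dS} {S : measurableType dS}
    (X : I -> Om -> S) : Prop :=
  forall (J : seq I) (A : I -> set S), uniq J ->
    (forall j, j \in J -> measurable (A j)) ->
    P (\big[setI/setT]_(j <- J) (X j @^-1` A j)) =
    (\prod_(j <- J) P (X j @^-1` A j))%E.

Definition Tmap {R : realType} {d : nat} (alpha : R) (xi : 'rV[R]_d) (x : 'rV[R]_d) :=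
  alpha *: x + (1 - alpha) *: xi.

Definition ftilde {R : realType} {d n : nat} (f : 'I_n -> 'rV[R]_d -> R)
    (alpha : 'I_n -> R) (xm : 'I_n -> 'rV[R]_d) (x : 'rV[R]_d) : R :=
  n%:R^-1 * \sum_(i < n) f i (Tmap (alpha i) (xm i) x).

Fixpoint dcgd {R : realType} {d n : nat} {Om : Type}
    (C : nat -> 'I_n -> Om -> 'rV[R]_d -> 'rV[R]_d)
    (g : 'I_n -> 'rV[R]_d -> 'rV[R]_d) (alpha : 'I_n -> R)
    (xm : 'I_n -> 'rV[R]_d) (gamma : R) (x0 : 'rV[R]_d) (k : nat) (w : Om)
    : 'rV[R]_d :=
  match k with
  | 0 => x0
  | k'.+1 =>
      let xk := dcgd C g alpha xm gamma x0 k' w in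
      xk - (gamma / n%:R) *:
             \sum_(i < n) C k' i w (alpha i *: g i (Tmap (alpha i) (xm i) xk))
  end.

Definition xbar {R : realType} {d : nat} {Om : Type} (x : nat -> Om -> 'rV[R]_d)
    (k : nat) (w : Om) : 'rV[R]_d :=
  k%:R^-1 *: \sum_(1 <= j < k.+1) x j w.

(* Main.v *)
Require Import Defs.
From HB Require Import structures.
From mathcomp Require Import all_boot all_order all_algebra.
From mathcomp Require Import all_classical all_reals all_analysis.
From mathcomp Require Import measurable_realfun ring lra.
Import Order.TTheory GRing.Theory Num.Theory.
Import numFieldNormedType.Exports.
Local Open Scope classical_set_scope.
Local Open Scope ring_scope.

(** Write h_i and G for the gradients of f_i o T_i and of their mean F, D_k for
    F(x^k) - F(x^* ), A for L_alpha + 2 M / n with M = max_i L_i om_i alpha_i^2, and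
    sigma for sigma_DCGD. Conditionally on x^k, the update direction is unbiased for
    G(x^k) and its variance is at most n^-2 sum_i om_i |h_i(x^k)|^2. The descent lemma
    gives |G(x^k)|^2 <= 2 A D_k (in particular G(x^* ) = 0), and cocoercivity of each
    gradient gives n^-2 sum_i om_i |h_i(x^k)|^2 <= (4 M / n) D_k + sigma. As
    4 gamma A <= 1, this yields
      E|x^(k+1) - x^*|^2 + gamma E D_k <= E|x^k - x^*|^2 + gamma^2 sigma,
    and summing over k and using convexity of F concludes.

    The expectation is handled without conditional expectations: exact gradients are
    replaced by compressed ones one index at a time, and at each replacement the seed
    of the compressor is independent of everything drawn before, so that Tonelli
    reduces the estimate to a compressor applied to a fixed vector. All integrands
    are nonnegative, hence the cross terms never need to be integrated globally. *)

(** * Smooth convex functions *)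

Section Euclidean.
Context {R : realType} {d : nat}.
Implicit Types (x y z : 'rV[R]_d) (a : R).

Lemma dotvC x y : dotv x y = dotv y x.
Proof. by apply: eq_bigr => j _; rewrite mulrC. Qed.

Lemma dotvDl x y z : dotv (x + y) z = dotv x z + dotv y z.
Proof. by rewrite -big_split; apply: eq_bigr => j _; rewrite mxE mulrDl. Qed.

Lemma dotvZl a x y : dotv (a *: x) y = a * dotv x y.
Proof. by rewrite /dotv mulr_sumr; apply: eq_bigr => j _; rewrite mxE mulrA. Qed.

Lemma dotvNl x y : dotv (- x) y = - dotv x y.
Proof. by rewrite -scaleN1r dotvZl mulN1r. Qed.

Lemma dotvDr x y z : dotv x (y + z) = dotv x y + dotv x z.
Proof. by rewrite !(dotvC x) dotvDl. Qed.

Lemma dotvZr a x y : dotv x (a *: y) = a * dotv x y.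
Proof. by rewrite !(dotvC x) dotvZl. Qed.

Lemma dotvNr x y : dotv x (- y) = - dotv x y.
Proof. by rewrite !(dotvC x) dotvNl. Qed.

Definition dotvE := (dotvDl, dotvDr, dotvNl, dotvNr, dotvZl, dotvZr).

Lemma dotv_suml (I : Type) (s : seq I) (F : I -> 'rV[R]_d) y :
  dotv (\sum_(i <- s) F i) y = \sum_(i <- s) dotv (F i) y.
Proof.
elim: s => [|i s IH]; last by rewrite !big_cons dotvDl IH.
by rewrite !big_nil; apply: big1 => j _; rewrite mxE mul0r.
Qed.

Lemma sqnorm_ge0 x : 0 <= sqnorm x.
Proof. by apply: sumr_ge0 => j _; rewrite -expr2 sqr_ge0. Qed.

Lemma sqnorm_eq0 x : sqnorm x = 0 -> x = 0.
Proof.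
move=> /eqP; rewrite psumr_eq0 => [/allP x0|j _]; last by rewrite -expr2 sqr_ge0.
apply/rowP => j; rewrite mxE; apply/eqP.
by have := x0 j (mem_index_enum j); rewrite mulf_eq0 orbb.
Qed.

Lemma sqnormD x y : sqnorm (x + y) = sqnorm x + 2 * dotv x y + sqnorm y.
Proof. by rewrite /sqnorm !dotvE (dotvC y x); ring. Qed.

Lemma sqnormZ a x : sqnorm (a *: x) = a ^+ 2 * sqnorm x.
Proof. by rewrite /sqnorm !dotvE; ring. Qed.

Lemma sqnormN x : sqnorm (- x) = sqnorm x.
Proof. by rewrite /sqnorm !dotvE; ring. Qed.

Lemma sqnormB x y : sqnorm (x - y) = sqnorm x - 2 * dotv x y + sqnorm y.
Proof. by rewrite sqnormD dotvNr sqnormN; ring. Qed.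

Lemma sqnormD_le x y : sqnorm (x + y) <= 2 * (sqnorm x + sqnorm y).
Proof. by have := sqnorm_ge0 (x - y); rewrite sqnormB sqnormD; lra. Qed.

Lemma enorm_ge0 x : 0 <= enorm x.
Proof. exact: sqrtr_ge0. Qed.

Lemma enorm_sqr x : enorm x ^+ 2 = sqnorm x.
Proof. by rewrite sqr_sqrtr// sqnorm_ge0. Qed.

Lemma enorm_eq0 x : enorm x = 0 -> x = 0.
Proof. by move=> x0; apply: sqnorm_eq0; rewrite -enorm_sqr x0 expr0n. Qed.

Lemma enormZ a x : 0 <= a -> enorm (a *: x) = a * enorm x.
Proof.
by move=> a0; rewrite /enorm sqnormZ sqrtrM ?sqr_ge0// sqrtr_sqr ger0_norm.
Qed.

(** Cauchy-Schwarz: [sqnorm (sqnorm y *: x - dotv x y *: y)] is nonnegative and equals [sqnorm y]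
    times the difference of the squared sides. *)
Lemma normr_dotv_le x y : `|dotv x y| <= enorm x * enorm y.
Proof.
have [->|y0] := eqVneq y 0.
  by rewrite -(scale0r y) dotvZr mul0r normr0 mulr_ge0// enorm_ge0.
have sy : 0 < sqnorm y.
  by rewrite lt_neqAle sqnorm_ge0 andbT eq_sym; apply: contra_neq y0 => /sqnorm_eq0.
rewrite -(@ler_pXn2r _ 2)// ?nnegrE ?mulr_ge0 ?enorm_ge0//.
rewrite exprMn !enorm_sqr -normrX ger0_norm ?sqr_ge0//.
rewrite -(ler_pM2l sy) -subr_ge0.
have := sqnorm_ge0 (sqnorm y *: x - dotv x y *: y).
by rewrite sqnormB !sqnormZ !dotvE -/(sqnorm y); congr (0 <= _); ring.
Qed.

End Euclidean.

(** * First-order inequalities for convex functions with Lipschitz gradient *)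

Section Smooth.
Context {R : realType} {d : nat} {f : 'rV[R]_d -> R} {g : 'rV[R]_d -> 'rV[R]_d}.
Implicit Types (x y v : 'rV[R]_d).

Lemma is_derive_line x v (t : R) : is_gradient f g ->
  is_derive t (1 : R) (fun s : R => f (x + s *: v)) (dotv (g (x + t *: v)) v).
Proof.
move=> fg; have [df gE] := fg (x + t *: v).
(* The two difference quotients agree as functions of the increment, so derivability and the
   derivative transfer without a chain rule. *)
have quotE : (fun h : R => h^-1 *: (f (x + (h *: (1 : R) + t) *: v) - f (x + t *: v))) =
    (fun h : R => h^-1 *: (f (h *: v + (x + t *: v)) - f (x + t *: v))).
  by apply/funext => h; rewrite scalerDl addrCA [h *: 1]mulr1.
have dv : derivable f (x + t *: v) v by exact: diff_derivable.
split; first by rewrite /derivable quotE.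
by rewrite /derive quotE -gE -deriveE.
Qed.

Lemma mean_value x v : is_gradient f g ->
  exists2 t : R, 0 < t < 1 & f (x + v) - f x = dotv (g (x + t *: v)) v.
Proof.
move=> fg.
have [||t t01] := @MVT R (fun s => f (x + s *: v))
  (fun t => dotv (g (x + t *: v)) v) 0 1 ltr01.
- by move=> t _; exact: is_derive_line.
- apply: derivable_within_continuous => t _.
  by have [] := is_derive_line x v t fg.
- rewrite scale1r scale0r addr0 subr0 mulr1 => ->.
  by exists t => //; rewrite in_itv in t01.
Qed.

Lemma dotv_gradB_le (L : R) x v (t : R) : L_smooth f g L -> 0 <= t ->
  `|dotv (g (x + t *: v) - g x) v| <= L * t * sqnorm v.
Proof.
move=> [_ gL] t0; apply: le_trans (normr_dotv_le _ _) _.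
rewrite -enorm_sqr expr2 mulrA ler_wpM2r ?enorm_ge0//.
by apply: le_trans (gL _ _) _; rewrite addrAC subrr add0r enormZ// mulrA.
Qed.

(** The mean value theorem replaces integration of the gradient: [phi] is [f] along the segment
    minus the linear and quadratic terms of the bound, and [dotv_gradB_le] makes its derivative
    nonpositive on (0, 1), so [phi 1 <= phi 0]. *)
Lemma descent (L : R) x v : L_smooth f g L ->
  f (x + v) <= f x + dotv (g x) v + L / 2 * sqnorm v.
Proof.
move=> fgL; have [fg _] := fgL.
pose b := dotv (g x) v; pose c := L / 2 * sqnorm v.
pose phi := (fun s : R => f (x + s *: v)) - (b \*: (@id R) + c \*: (@id R) ^+ 2).
have dphi (t : R) : is_derive t (1 : R) phi
    (dotv (g (x + t *: v)) v - (b + t * 2 * c)).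
  have dl := is_derive_line x v t fg.
  apply: is_derive_eq; rewrite /GRing.scale/= expr1; ring.
have [|t] := @MVT R phi (fun t => dotv (g (x + t *: v)) v - (b + t * 2 * c)) 0 1 ltr01.
- by apply: derivable_within_continuous => t _; have [] := dphi t.
- rewrite in_itv/= => /andP[t0 _].
  have := dotv_gradB_le _ x v _ fgL (ltW t0).
  rewrite ler_norml => /andP[_]; rewrite dotvDl dotvNl -/b.
  rewrite /phi /= !fctE scale1r scale0r addr0 /GRing.scale/=.
  rewrite {1}/c; set s := sqnorm v; set u := dotv _ v.
  move=> h; rewrite expr1n expr0n /= !scaler0 !addr0 !subr0 mulr1 ![_ *: 1]mulr1.
  by rewrite /c -/s => e; lra.
Qed.

(** Convexity between [x] and [x + t *: v] combined with the mean value theorem gives the tangent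
    inequality up to an error [t * c], controlled by the Lipschitz bound on [g]; then [t] is taken
    arbitrarily small. *)
Lemma convex_gradient (L : R) x y : convex_fun f -> L_smooth f g L ->
  f x + dotv (g x) (y - x) <= f y.
Proof.
move=> fc fgL; have [fg _] := fgL; pose v := y - x.
pose c := `|L * sqnorm v|.
suff tP (t : R) : 0 < t <= 1 -> f x + dotv (g x) v - t * c <= f y.
  apply/ler_addgt0Pr => e e0; rewrite -lerBlDr.
  (* This choice keeps [t] in (0, 1] and gives [t * c <= e]; adding 1 to [c] avoids a zero
     denominator. *)
  pose t := Num.min 1 (e / (c + 1)).
  have c1 : 0 < c + 1 by rewrite ltr_wpDl ?normr_ge0.
  apply: le_trans (tP t _); last first.
    by rewrite lt_min ltr01 divr_gt0//= ge_min lexx.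
  rewrite lerB//.
  have : t * c <= e / (c + 1) * (c + 1).
    by rewrite ler_pM// ?normr_ge0 ?le_min ?ler01 ?divr_ge0 ?(ltW e0) ?(ltW c1) ?ge_min
      ?lexx ?orbT ?lerDl.
  by rewrite divfK// gt_eqF.
move=> /andP[t0 t1].
have [s /andP[s0 s1] fE] := mean_value x (t *: v) fg.
have := fc y x t; rewrite (ltW t0) t1 => /(_ isT).
have -> : t *: y + (1 - t) *: x = x + t *: v.
  by apply/rowP => j; rewrite !mxE; ring.
move: fE; rewrite dotvZr scalerA.
have := dotv_gradB_le _ x v _ fgL (ltW (mulr_gt0 s0 t0)).
rewrite ler_norml => /andP[+ _]; rewrite dotvDl dotvNl.
have cP : L * (s * t) * sqnorm v <= t * c.
  rewrite (_ : _ * _ = t * (s * (L * sqnorm v))); last by ring.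
  rewrite ler_wpM2l ?(ltW t0)//; apply: le_trans (ler_norm _) _.
  by rewrite normrM gtr0_norm// ler_piMl// ltW.
set u := dotv (g (_ + _)) v; set w := dotv (g x) v => h1 h2 h3.
have h4 : t * (w - t * c) <= t * (f y - f x) by nra.
by move: h4; rewrite ler_pM2l//; lra.
Qed.

(** The value of [f] at the gradient step [z = x - L^-1 *: D] is bounded below by the tangent at [y]
    and above by the descent lemma at [x]; comparing the two bounds gives the estimate. *)
Lemma cocoercive (L : R) x y : convex_fun f -> L_smooth f g L ->
  sqnorm (g x - g y) <= 2 * L * (f x - f y - dotv (g y) (x - y)).
Proof.
move=> fc fgL; have [_ gL] := fgL.
have [L0|L0] := ltP 0 L.
  pose D := g x - g y; pose z := x - L^-1 *: D.
  have h1 := convex_gradient L y z fc fgL.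
  have h2 := descent L x (- (L^-1 *: D)) fgL.
  have h3 : sqnorm D = dotv (g x) D - dotv (g y) D by rewrite /sqnorm {1}/D !dotvE.
  move: h1 h2; rewrite -/z {2}/z addrAC !dotvDr !dotvNr !dotvZr sqnormN sqnormZ -/D.
  rewrite (_ : L / 2 * (L^-1 ^+ 2 * sqnorm D) = L^-1 * sqnorm D / 2); last first.
    by field; rewrite gt_eqF.
  move=> h1 h2; rewrite -(ler_pM2l (_ : 0 < L^-1)) ?invr_gt0//.
  by rewrite (mulrC 2) -mulrA mulKf ?gt_eqF//; nra.
(* For [L <= 0] the Lipschitz bound forces [g x = g y]. The right-hand side then vanishes too:
   trivially if [L = 0], and because [x = y] if [L < 0]. *)
have n0 : enorm (g x - g y) = 0.
  apply/eqP; rewrite eq_le enorm_ge0 andbT.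
  by apply: le_trans (gL _ _) _; rewrite mulr_le0_ge0// enorm_ge0.
rewrite -enorm_sqr n0 expr0n/=.
move: L0; rewrite le_eqVlt => /orP[/eqP->|L0]; first by rewrite mulr0 mul0r.
have /enorm_eq0/subr0_eq -> : enorm (x - y) = 0.
  apply/eqP; rewrite eq_le enorm_ge0 andbT -(ler_nM2l L0) mulr0 -n0; exact: gL.
by rewrite !subrr -(scale0r y) dotvZr mul0r subrr mulr0.
Qed.

End Smooth.

(* L_smooth allows L < 0 in dimension 0, where all points coincide. *)
Lemma L_smooth_neg_eq {R : realType} {d : nat} {f : 'rV[R]_d -> R}
    {g : 'rV[R]_d -> 'rV[R]_d} (L : R) (x y : 'rV[R]_d) :
  L_smooth f g L -> L < 0 -> x = y.
Proof.
move=> [_ gL] L0; apply/subr0_eq/enorm_eq0/eqP; rewrite eq_le enorm_ge0 andbT.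
by rewrite -(ler_nM2l L0) mulr0 (le_trans (enorm_ge0 _) (gL _ _)).
Qed.

Lemma TmapB {R : realType} {d : nat} (alpha : R) (xi x y : 'rV[R]_d) :
  Tmap alpha xi x - Tmap alpha xi y = alpha *: (x - y).
Proof. by apply/rowP => j; rewrite !mxE; ring. Qed.

Lemma convex_funM_mean {R : realType} {d : nat} (f : 'rV[R]_d -> R)
    (x : nat -> 'rV[R]_d) (k : nat) : convex_fun f -> (0 < k)%N ->
  k%:R * f (k%:R^-1 *: \sum_(1 <= j < k.+1) x j) <= \sum_(1 <= j < k.+1) f (x j).
Proof.
move=> fc; case: k => // k _; elim: k => [|k IH].
  by rewrite !big_nat1 invr1 scale1r mul1r.
rewrite (big_nat_recr k.+2)//= [X in _ <= X](big_nat_recr k.+2)//=.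
set s := \sum_(1 <= j < k.+2) x j in IH *.
have k1 : (k.+1%:R : R) != 0 by rewrite pnatr_eq0.
have k2 : (k.+2%:R : R) != 0 by rewrite pnatr_eq0.
have k12 : (k.+2%:R : R) = k.+1%:R + 1 by rewrite -natr1.
(* With this weight, the mean of the first [k.+2] points is a convex combination of the mean of the
   first [k.+1] and the last one. *)
pose t : R := k.+1%:R / k.+2%:R.
have := fc (k.+1%:R^-1 *: s) (x k.+2) t.
have -> : t *: (k.+1%:R^-1 *: s) + (1 - t) *: x k.+2 = k.+2%:R^-1 *: (s + x k.+2).
  rewrite scalerA scalerDr; congr (_ *: _ + _ *: _); rewrite /t.
    by rewrite mulrAC mulfV ?mul1r.
  by apply: (mulIf k2); rewrite mulrBl divfK// mul1r mulVf// k12 addrAC subrr add0r.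
have -> : 0 <= t <= 1.
  by rewrite /t divr_ge0 ?ler0n//= ler_pdivrMr ?ltr0n// mul1r ler_nat.
move=> /(_ isT); rewrite -(ler_pM2l (_ : 0 < k.+2%:R :> R)) ?ltr0n//.
move=> /le_trans; apply.
have tk : k.+2%:R * t = k.+1%:R by rewrite /t mulrC divfK.
rewrite mulrDr !mulrA mulrBr mulr1 tk lerD//.
  by rewrite [_ * _ / _]mulrAC mulfV// mul1r.
by rewrite k12 addrAC subrr add0r mul1r.
Qed.

(** * One step of the method, with the compression error averaged out *)

Section Problem.
Context {R : realType} {d n : nat}.
Variables (f : 'I_n -> 'rV[R]_d -> R) (g : 'I_n -> 'rV[R]_d -> 'rV[R]_d).
Variables (L alpha om : 'I_n -> R) (xm : 'I_n -> 'rV[R]_d) (xs : 'rV[R]_d).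
Hypothesis n0 : (0 < n)%N.
Hypothesis fc : forall i, convex_fun (f i).
Hypothesis fgL : forall i, L_smooth (f i) (g i) (L i).
Hypothesis xsmin : is_minimizer (ftilde f alpha xm) xs.
Hypothesis om0 : forall i, 0 <= om i.

Notation T i := (Tmap (alpha i) (xm i)).
Notation F := (ftilde f alpha xm).

Definition dcgd_grad (i : 'I_n) (x : 'rV[R]_d) : 'rV[R]_d := alpha i *: g i (T i x).
Definition dcgd_mean_grad (x : 'rV[R]_d) : 'rV[R]_d :=
  n%:R^-1 *: \sum_(i < n) dcgd_grad i x.
Notation h := dcgd_grad.
Notation G := dcgd_mean_grad.

Let n_neq0 : (n%:R : R) != 0. Proof. by rewrite pnatr_eq0 -lt0n. Qed.
Let n_gt0 : 0 < (n%:R : R). Proof. by rewrite ltr0n. Qed.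

Lemma ftilde_convex : convex_fun F.
Proof.
move=> x y t t01; rewrite /ftilde !mulrA ![_ / n%:R]mulrC -!mulrA -mulrDr.
rewrite ler_pM2l ?invr_gt0// !mulr_sumr -big_split; apply: ler_sum => i _ /=.
apply: le_trans _ (fc i _ _ _ t01); rewrite le_eqVlt; apply/orP; left; apply/eqP.
by congr f; apply/rowP => j; rewrite !mxE; ring.
Qed.

Lemma dotv_mean_grad x v :
  dotv (G x) v = n%:R^-1 * \sum_(i < n) alpha i * dotv (g i (T i x)) v.
Proof.
by rewrite dotvZl dotv_suml; congr (_ * _); apply: eq_bigr => i _; rewrite dotvZl.
Qed.

Lemma ftilde_gradient x y : F x + dotv (G x) (y - x) <= F y.
Proof.
rewrite dotv_mean_grad /ftilde -mulrDr -big_split ler_pM2l ?invr_gt0//.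
apply: ler_sum => i _ /=; rewrite -dotvZr -(TmapB _ (xm i)).
exact: convex_gradient.
Qed.

Notation La := (n%:R^-1 * \sum_(i < n) alpha i ^+ 2 * L i).

(** Moving [x] by [v] moves [T i x] by [alpha i *: v], so the quadratic term of each summand
    acquires [alpha i ^+ 2]. *)
Lemma ftilde_descent x v :
  F (x + v) <= F x + dotv (G x) v + La / 2 * sqnorm v.
Proof.
rewrite dotv_mean_grad /ftilde -!mulrA -!mulrDr ler_pM2l ?invr_gt0//.
rewrite mulr_suml -!big_split; apply: ler_sum => i _ /=.
have := descent (L i) (T i x) (alpha i *: v) (fgL i).
rewrite (_ : T i x + _ = T i (x + v)); last first.
  by apply/rowP => j; rewrite !mxE; ring.
by rewrite dotvZr sqnormZ => /le_trans; apply; lra.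
Qed.

(** A gradient step of length [A^-1] from [x] cannot go below [F xs]. Any positive upper bound [A]
    is allowed because the smoothness constant itself may vanish. *)
Lemma sqnorm_mean_grad_le (A : R) x : 0 < A -> La <= A ->
  sqnorm (G x) <= 2 * A * (F x - F xs).
Proof.
move=> A0 LA; have h1 := xsmin (x - A^-1 *: G x).
have h2 := ftilde_descent x (- (A^-1 *: G x)).
move: (le_trans h1 h2); rewrite dotvNr dotvZr -/(sqnorm (G x)) sqnormN (sqnormZ A^-1) => h3.
have h4 : La / 2 * (A^-1 ^+ 2 * sqnorm (G x)) <= A / 2 * (A^-1 ^+ 2 * sqnorm (G x)).
  apply: ler_wpM2r; [by rewrite mulr_ge0 ?sqr_ge0 ?sqnorm_ge0|by rewrite ler_pM2r].
have h5 : A / 2 * (A^-1 ^+ 2 * sqnorm (G x)) = A^-1 * sqnorm (G x) / 2.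
  by field; rewrite gt_eqF.
rewrite -(ler_pM2l (_ : 0 < A^-1)) ?invr_gt0//.
by rewrite (mulrC 2 A) -mulrA mulKf ?gt_eqF//; lra.
Qed.

Notation M := (\big[Num.max/0]_(i < n) (L i * om i * alpha i ^+ 2)).
Notation sigma := (2 / (n%:R ^+ 2) *
      \sum_(i < n) om i * alpha i ^+ 2 * sqnorm (g i (T i xs))).

(** Each [g i (T i x)] is split around [g i (T i xs)]. Cocoercivity bounds the difference by
    [2 * L i] times the Bregman divergence [D i], and the fixed part sums to [sigma]. As [G xs = 0],
    the linear terms cancel on average and the [D i] have mean [F x - F xs]. *)
Lemma compression_noise_le x : G xs = 0 ->
  (n%:R ^+ 2)^-1 * \sum_(i < n) om i * sqnorm (h i x) <=
    4 * M / n%:R * (F x - F xs) + sigma.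
Proof.
move=> Gxs.
pose D i := f i (T i x) - f i (T i xs) - dotv (g i (T i xs)) (T i x - T i xs).
have D0 i : 0 <= D i by rewrite /D -addrA -opprD subr_ge0; exact: convex_gradient.
have sumD : F x - F xs = n%:R^-1 * \sum_(i < n) D i.
  have : dotv (G xs) (x - xs) = 0 by rewrite Gxs -(scale0r xs) dotvZl mul0r.
  move=> e; transitivity (F x - F xs - dotv (G xs) (x - xs)); first by rewrite e subr0.
  rewrite dotv_mean_grad /ftilde -!mulrBr -!sumrB.
  by congr (_ * _); apply: eq_bigr => i _; rewrite /D TmapB dotvZr.
rewrite sumD.
have -> : 4 * M / n%:R * (n%:R^-1 * \sum_(i < n) D i) =
    (n%:R ^+ 2)^-1 * (4 * M * \sum_(i < n) D i) by field.
rewrite (mulrC 2) -[_^-1 * 2 * _]mulrA -mulrDr ler_pM2l ?invr_gt0 ?exprn_gt0//.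
rewrite !mulr_sumr -big_split; apply: ler_sum => i _ /=.
rewrite /h sqnormZ mulrA.
have cM : om i * alpha i ^+ 2 * L i <= M.
  by rewrite (_ : _ * L i = L i * om i * alpha i ^+ 2); [exact: le_bigmax|ring].
have cD := cocoercive (L i) (T i x) (T i xs) (fc i) (fgL i).
have := sqnormD_le (g i (T i x) - g i (T i xs)) (g i (T i xs)); rewrite subrK => cS.
have w0 : 0 <= om i * alpha i ^+ 2 by rewrite mulr_ge0 ?sqr_ge0.
have := ler_wpM2r (D0 i) cM; move: cD w0 cS; rewrite -/(D i) -/(T i xs).
move: (om i * alpha i ^+ 2) (sqnorm _) (sqnorm _) (sqnorm _) (D i) => w e b a Di.
move=> h1 w0 h2 h3.
have h4 : w * b <= w * (2 * (2 * L i * Di + e)) by rewrite ler_wpM2l//; lra.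
by apply: le_trans h4 _; lra.
Qed.

Lemma dcgd_step (gamma : R) x : 0 < gamma -> gamma <= (4 * (La + 2 * M / n%:R))^-1 ->
  sqnorm (x - xs - gamma *: G x) + (gamma / n%:R) ^+ 2 * \sum_(i < n) om i * sqnorm (h i x)
    + gamma * (F x - F xs) <= sqnorm (x - xs) + gamma ^+ 2 * sigma.
Proof.
move=> gamma0 gammaA; set A := La + 2 * M / n%:R in gammaA.
(* A nonpositive [A] would make the bound on [gamma] nonpositive, as [0^-1 = 0]. *)
have A0 : 0 < A.
  by have := lt_le_trans gamma0 gammaA; rewrite invr_gt0 pmulr_rgt0.
have M0 : 0 <= 2 * M / n%:R.
  by rewrite divr_ge0 ?ler0n// mulr_ge0//; exact: bigmax_ge_id.
have LaA : La <= A by rewrite lerDl.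
have Gxs : G xs = 0.
  apply: sqnorm_eq0; apply/eqP; rewrite eq_le sqnorm_ge0 andbT.
  by have := sqnorm_mean_grad_le A xs A0 LaA; rewrite subrr mulr0.
have h1 := compression_noise_le x Gxs.
have h2 := sqnorm_mean_grad_le A x A0 LaA.
have F0 : 0 <= F x - F xs by rewrite subr_ge0; exact: xsmin.
(* Needed because [4 * A] exceeds the coefficient [2 * A + 4 * M / n%:R] found below by [2 * La]. A
   negative [L i] forces [x = xs], where the gap is zero. *)
have LaF : 0 <= La * (F x - F xs).
  have [L0|/existsNP[i /negP]] := pselect (forall i, 0 <= L i).
    rewrite mulr_ge0// mulr_ge0 ?invr_ge0 ?ler0n// sumr_ge0// => i _.
    by rewrite mulr_ge0 ?sqr_ge0.
  by rewrite -ltNge => Li0; rewrite (L_smooth_neg_eq _ x xs (fgL i) Li0) subrr mulr0.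
have := ler_wpM2r F0 gammaA.
rewrite sqnormB (sqnormZ gamma) dotvZr (dotvC _ (G x)) exprMn exprVn.
have h3 := ftilde_gradient x xs; rewrite -opprB dotvNr in h3.
have gA : gamma * A <= 4^-1.
  by move: gammaA; rewrite invfM ler_pdivlMr// mulrC.
have h4 : gamma * (gamma * (4 * A * (F x - F xs))) <= gamma * (F x - F xs).
  rewrite ler_pM2l// (_ : _ * _ = 4 * (gamma * A) * (F x - F xs)); last by ring.
  by rewrite ler_piMl//; lra.
have h5 : gamma ^+ 2 * (sqnorm (G x) + (n%:R ^+ 2)^-1 * \sum_(i < n) om i * sqnorm (h i x))
    <= gamma ^+ 2 * (4 * A * (F x - F xs) + sigma).
  rewrite ler_pM2l ?exprn_gt0//; apply: le_trans (lerD h2 h1) _.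
  by rewrite addrA lerD2r /A; lra.
(* Expanding the square yields this inner product twice: one copy pays for the quadratic terms
   through [h4] and [h5], the other leaves the gap on the left-hand side. *)
have h6 : gamma * (F x - F xs) <= gamma * dotv (G x) (x - xs).
  by rewrite ler_pM2l//; lra.
move: h4 h5 h6; lra.
Qed.
End Problem.

(** * Tonelli for independent variables *)

Section Independence.
Local Open Scope ereal_scope.
Context {R : realType} {dO d1 d2 : measure_display} {Om : measurableType dO}
  {T1 : measurableType d1} {T2 : measurableType d2} (P : probability Om R).
Variables (X : {mfun Om >-> T1}) (Y : {mfun Om >-> T2}).

(** For fixed [A], the sets [B] satisfying the product formula form a Dynkin system, so a generator
    stable under intersection suffices. *)
Lemma independent_generated (G : set (set T2)) (A : set T1) :
  @measurable _ T2 = <<s G >> -> setI_closed G -> measurable A ->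
  (forall B, G B -> P (X @^-1` A `&` Y @^-1` B) = P (X @^-1` A) * P (Y @^-1` B)) ->
  forall B, measurable B -> P (X @^-1` A `&` Y @^-1` B) = P (X @^-1` A) * P (Y @^-1` B).
Proof.
move=> GE GI mA GP B; rewrite GE; move: B.
have mX : measurable (X @^-1` A) by exact: measurable_funPTI.
have mY B : measurable B -> measurable (Y @^-1` B) by exact: measurable_funPTI.
apply: (dynkin_induction (G := G) (P := fun B =>
  P (X @^-1` A `&` Y @^-1` B) = P (X @^-1` A) * P (Y @^-1` B))) => //.
- by rewrite preimage_setT setIT probability_setT mule1.
- move=> B mB PB; rewrite preimage_setC -setDE measureD//=; last 2 first.
  + exact: mY.
  + by rewrite (le_lt_trans (probability_le1 _ _))// ltry.
  rewrite PB probability_setC ?muleBr ?mule1//; last exact: mY.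
  + exact: fin_num_measure.
- move=> F mF tF PF; rewrite preimage_bigcup setI_bigcupr.
  have tY : trivIset setT (fun k => Y @^-1` F k).
    by apply/trivIsetP => i j _ _ ij; rewrite -preimage_setI (trivIsetP.1 tF)// preimage_set0.
  rewrite !measure_bigcup//=.
  + rewrite -[P (X @^-1` A)]fineK ?fin_num_measure// -nneseriesZl//.
    by apply: eq_eseriesr => k _; rewrite fineK ?fin_num_measure.
  + by move=> k _; exact: mY.
  + by move=> k _; apply: measurableI => //; exact: mY.
  + exact: trivIset_setIl.
Qed.

(** The product formula on rectangles identifies the law of the pair with the product of the two
    laws. The inner integral, with [Y w] frozen, stands in for a conditional expectation given
    [Y]. *)
Lemma independent_tonelli (f : T1 * T2 -> \bar R) :
  (forall A B, measurable A -> measurable B ->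
    P (X @^-1` A `&` Y @^-1` B) = P (X @^-1` A) * P (Y @^-1` B)) ->
  measurable_fun setT f -> (forall z, 0 <= f z) ->
  \int[P]_w f (X w, Y w) = \int[P]_w \int[P]_v f (X v, Y w).
Proof.
move=> XY mf f0.
have mXY : measurable_fun setT (fun w => (X w, Y w)) by exact: measurable_fun_pair.
pose Z : {mfun Om >-> (T1 * T2)%type} := HB.pack (fun w => (X w, Y w))
  (isMeasurableFun.Build _ _ _ _ _ mXY).
rewrite -[LHS](ge0_integral_distribution Z)//.
rewrite (eq_measure_integral (distribution P X \x distribution P Y)); last first.
  move=> A mA _; apply/esym; apply: product_measure_unique => // *; exact: XY.
rewrite fubini_tonelli2// ge0_integral_distribution//.
- apply: eq_integral => w _; rewrite /fubini_G/=.
  rewrite (ge0_integral_distribution X (f := fun x => f (x, Y w)))//.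
  by apply: measurableT_comp => //; exact: measurable_pair2.
- exact: measurable_fun_fubini_tonelli_G.
- by move=> y; apply: integral_ge0.
Qed.

End Independence.

(** * Borel measurability in R^d *)

Section BorelRow.
Context {R : realType} {d : nat}.

(** The measurable sets are those of [borel_rV], so that [jointly_measurable] becomes measurability
    on a product type. *)
Definition borelRow := g_sigma_algebraType (open : set (set 'rV[R]_d)).
HB.instance Definition _ := Measurable.on borelRow.

Definition coord_measurable {dT} {T : measurableType dT} (h : T -> 'rV[R]_d) : Prop :=
  forall j, measurable_fun setT (fun t => h t ord0 j).

Section CoordMeasurable.
Context {dT : measure_display} {T : measurableType dT}.
Implicit Types h : T -> 'rV[R]_d.

Lemma measurable_preimage_ball h (q : 'rV[R]_d) (e : R) :
  coord_measurable h -> measurable (h @^-1` ball q e).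
Proof.
move=> mh; have [e0|e0] := ltP 0 e; last first.
  rewrite (_ : _ @^-1` _ = set0)//; apply/seteqP; split => // t [/=].
  by rewrite ltNge e0.
rewrite (_ : _ @^-1` _ =
    \big[setI/setT]_(j < d) ((fun t => h t ord0 j) @^-1` ball (q ord0 j) e)).
  apply: bigsetI_measurable => j _; rewrite -[X in measurable X]setTI.
  by apply: mh => //; apply: open_measurable; exact: ball_open.
rewrite -bigcap_seq; apply/seteqP; split => t /=.
  by move=> [_ qe] j _; exact: qe.
by move=> qe; split => // i j; rewrite ord1; exact/qe/mem_index_enum.
Qed.

(** An open set is the countable union of the balls inside it that have a rational centre and radius
    [m.+1%:R^-1]. *)
Lemma measurable_preimage_open h (U : set 'rV[R]_d) :
  coord_measurable h -> open U -> measurable (h @^-1` U).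
Proof.
move=> mh oU.
pose B (q : 'rV[rat]_d * nat) := ball (map_mx ratr q.1 : 'rV[R]_d) q.2.+1%:R^-1.
have -> : h @^-1` U = \bigcup_q (if `[< B q `<=` U >] then h @^-1` B q else set0).
  apply/seteqP; split => [t Ut|t [q _]]; last first.
    by case: asboolP => // qU; exact: qU.
  have /nbhs_ballP[e /= e0 eU] : nbhs (h t) U by apply: open_nbhs_nbhs.
  (* A ball of this radius that contains [h t] stays within [e] of [h t], by the triangle inequality
     through its centre. *)
  have [m me] : exists m, m.+1%:R^-1 < e / 2.
    by have [m] := ltr_add_invr (divr_gt0 e0 (ltr0n R 2)); rewrite add0r; exists m.
  have /choice[q qE] (j : 'I_d) : exists q : rat, `|h t ord0 j - ratr q| < m.+1%:R^-1.
    have [|q] := @rat_in_itvoo R (h t ord0 j - m.+1%:R^-1) (h t ord0 j + m.+1%:R^-1).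
      by rewrite ltrD2l gtrN ?invr_gt0.
    by rewrite in_itv/= => qj; exists q; rewrite distrC ltr_distl.
  exists (\row_j q j, m) => //.
  have tB : B (\row_j q j, m) (h t).
    split => //= i j; rewrite !mxE ord1 /ball/= distrC; exact: qE.
  case: asboolP => //; case.
  move=> y By; apply: eU; apply: le_ball (ball_triangle (ball_sym tB) By) => /=.
  by rewrite [leRHS](splitr e) lerD// ltW.
apply: countable_bigcupT_measurable => [|q]; first exact: countableP.
by case: ifP => // _; exact: measurable_preimage_ball.
Qed.

End CoordMeasurable.

Lemma continuous_borelRow_measurable (phi : 'rV[R]_d -> R) :
  continuous phi -> measurable_fun setT (phi : borelRow -> R).
Proof.
move=> /continuousP cphi.
apply: (measurability _ (RGenOInfty.measurableE R)) => _ [_ [x ->] <-].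
by rewrite setTI; apply: sub_sigma_algebra; apply: cphi; exact: interval_open.
Qed.

Lemma measurable_borelRowP {dT : measure_display} {T : measurableType dT}
    (h : T -> 'rV[R]_d) :
  coord_measurable h <-> measurable_fun setT (h : T -> borelRow).
Proof.
split=> [mh|mh j].
  apply: (measurability (open : set (set borelRow))) => // _ [U oU <-].
  by rewrite setTI; exact: measurable_preimage_open.
apply: (measurableT_comp (f := fun x : borelRow => x ord0 j) _ mh).
by apply: continuous_borelRow_measurable; exact: coord_continuous.
Qed.

Lemma continuous_coord_measurable {dT : measure_display} {T : measurableType dT}
    (h : T -> 'rV[R]_d) (phi : 'rV[R]_d -> 'rV[R]_d) :
  continuous phi -> coord_measurable h -> coord_measurable (phi \o h).
Proof.
move=> cphi /measurable_borelRowP mh j.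
apply: (measurableT_comp (f := fun x : borelRow => phi x ord0 j) _ mh).
apply: continuous_borelRow_measurable => x.
apply: (@continuous_comp _ _ _ phi (fun y : 'rV[R]_d => y ord0 j)); first exact: cphi.
exact: coord_continuous.
Qed.

Lemma continuous_fun_measurable {dT : measure_display} {T : measurableType dT}
    (h : T -> 'rV[R]_d) (phi : 'rV[R]_d -> R) :
  continuous phi -> coord_measurable h -> measurable_fun setT (phi \o h).
Proof.
move=> cphi /measurable_borelRowP mh.
exact: (measurableT_comp (continuous_borelRow_measurable _ cphi) mh).
Qed.

Section CoordMeasurableOps.
Context {dT : measure_display} {T : measurableType dT}.
Implicit Types h : T -> 'rV[R]_d.

Lemma coord_measurable_cst (x : 'rV[R]_d) : coord_measurable (fun _ : T => x).
Proof. by move=> j; exact: measurable_cst. Qed.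

Lemma coord_measurableD h1 h2 : coord_measurable h1 -> coord_measurable h2 ->
  coord_measurable (fun t => h1 t + h2 t).
Proof.
move=> m1 m2 j; rewrite (_ : (fun _ => _) = (fun t => h1 t ord0 j + h2 t ord0 j)).
  exact: measurable_funD.
by apply/funext => t; rewrite mxE.
Qed.

Lemma coord_measurableZ (a : R) h : coord_measurable h ->
  coord_measurable (fun t => a *: h t).
Proof.
move=> mh j; rewrite (_ : (fun _ => _) = (fun t => a * h t ord0 j)).
  by apply: measurable_funM => //; exact: measurable_cst.
by apply/funext => t; rewrite mxE.
Qed.

Lemma coord_measurableB h1 h2 : coord_measurable h1 -> coord_measurable h2 ->
  coord_measurable (fun t => h1 t - h2 t).
Proof.
move=> m1 m2; apply: coord_measurableD => //.
by under eq_fun do rewrite -scaleN1r; exact: coord_measurableZ.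
Qed.

Lemma coord_measurable_sum (I : eqType) (s : seq I) (h : I -> T -> 'rV[R]_d) :
  (forall i, i \in s -> coord_measurable (h i)) ->
  coord_measurable (fun t => \sum_(i <- s) h i t).
Proof.
elim: s => [_|i s IH mh].
  by under eq_fun do rewrite big_nil; exact: coord_measurable_cst.
under eq_fun do rewrite big_cons; apply: coord_measurableD.
  by apply: mh; rewrite mem_head.
by apply: IH => j js; apply: mh; rewrite inE js orbT.
Qed.

Lemma measurable_sqnorm h : coord_measurable h ->
  measurable_fun setT (fun t => sqnorm (h t)).
Proof. by move=> mh; apply: measurable_sum => j; exact: measurable_funM. Qed.

Lemma jointly_measurable_comp {dS : measure_display} {S : measurableType dS}
    (c : S -> 'rV[R]_d -> 'rV[R]_d) (s : T -> S) h : jointly_measurable c ->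
  measurable_fun setT s -> coord_measurable h ->
  coord_measurable (fun t => c (s t) (h t)).
Proof.
move=> mc ms /measurable_borelRowP mh j.
have mcj : measurable_fun setT (fun p : S * borelRow => c p.1 p.2 ord0 j).
  move=> _ B mB; rewrite setTI; have := mc j B mB; rewrite measurable_prod_measurableType.
  apply: sub_sigma_algebra2 => _ [A [C [mA [mC ->]]]].
  by exists A => //; exists C.
exact: (measurableT_comp mcj (measurable_fun_pair ms mh)).
Qed.

End CoordMeasurableOps.

End BorelRow.

(** * Compressors and the history of the draws *)

Section Compressor.
Context {R : realType} {d : nat} {dO : measure_display} {Om : measurableType dO}
  (P : probability Om R) (C : Om -> 'rV[R]_d -> 'rV[R]_d) (om : R).
Hypothesis Bd : in_Bd P C om.
Implicit Types a x : 'rV[R]_d.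

Lemma in_Bd_dotv a x :
  P.-integrable setT (fun w => (dotv a (C w x - x))%:E) /\
  (\int[P]_w (dotv a (C w x - x))%:E = 0)%E.
Proof.
have [iC [EC _]] := Bd x.
have ix r : P.-integrable setT (fun _ : Om => r%:E).
  by apply: finite_measure_integrable_cst.
have iCx j : P.-integrable setT (fun w => (C w x ord0 j - x ord0 j)%:E).
  apply: (eq_integrable measurableT ((fun w => (C w x ord0 j)%:E) \- (fun=> (x ord0 j)%:E))%E).
    by move=> w _; rewrite /= EFinB.
  exact: integrableB.
have iaCx j : P.-integrable setT
    (fun w => (a ord0 j)%:E * (C w x ord0 j - x ord0 j)%:E)%E.
  exact: integrableZl.
have dotE : (fun w => (dotv a (C w x - x))%:E) =
    (fun w => \sum_(j < d) (a ord0 j)%:E * (C w x ord0 j - x ord0 j)%:E)%E.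
  by apply/funext => w; rewrite -sumEFin; apply: eq_bigr => j _; rewrite !mxE EFinM.
rewrite dotE; split; first exact: integrable_sum.
rewrite integral_sum// big1// => j _; rewrite integralZl//.
rewrite (_ : (fun _ => _) = ((fun w => (C w x ord0 j)%:E) \- (fun=> (x ord0 j)%:E))%E)//.
by rewrite integralB// EC integral_cst//= probability_setT mule1 subee// mule0.
Qed.

Lemma in_Bd_coord_measurable x : coord_measurable (fun w => C w x).
Proof.
by move=> j; have [iC _] := Bd x; apply/measurable_EFinP; exact: measurable_int (iC j).
Qed.

(** In the expanded square the cross term has mean zero by [in_Bd_dotv]. Since [a] and [x] are fixed
    vectors, every term is integrable. *)
Lemma in_Bd_perturb_le (t : R) a x :
  (\int[P]_w (sqnorm (a - t *: (C w x - x)))%:E <=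
    (sqnorm a + t ^+ 2 * (om * sqnorm x))%:E)%E.
Proof.
have [_ [_ VC]] := Bd x; have [il El] := in_Bd_dotv ((- 2 * t) *: a) x.
have mq : measurable_fun setT (fun w => (sqnorm (C w x - x))%:E).
  apply/measurable_EFinP; apply: measurable_sqnorm; apply: coord_measurableB.
    exact: in_Bd_coord_measurable.
  exact: coord_measurable_cst.
have iq : P.-integrable setT (fun w => (sqnorm (C w x - x))%:E).
  apply/integrableP; split=> //; apply: le_lt_trans (ltry (om * sqnorm x)).
  under eq_integral do rewrite abse_EFin ger0_norm ?sqnorm_ge0//.
  exact: VC.
rewrite (_ : (fun _ => _) = (fun w => ((sqnorm a)%:E +
    (dotv ((- 2 * t) *: a) (C w x - x))%:E) +
    (t ^+ 2)%:E * (sqnorm (C w x - x))%:E)%E); last first.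
  apply/funext => w; rewrite -EFinM -!EFinD; congr EFin.
  by rewrite (sqnormB a) (sqnormZ t) dotvZr dotvZl; ring.
have ia : P.-integrable setT (fun _ : Om => (sqnorm a)%:E).
  by apply: finite_measure_integrable_cst.
rewrite integralD//; [|exact: integrableD|exact: integrableZl].
rewrite integralD// El integral_cst//= probability_setT mule1 adde0 integralZl//.
by rewrite EFinD leeD2l// [leRHS]EFinM; apply: lee_wpmul2l; rewrite ?lee_fin ?sqr_ge0.
Qed.

End Compressor.

Section History.
Context {R : realType} {dO dS : measure_display} {Om : measurableType dO}
  {S : measurableType dS} {I : choiceType} (P : probability Om R) (X : I -> Om -> S).
Implicit Types (D : set I).

(* The cylinders, rather than the preimages of single coordinates, are taken as
   generators because they are stable under intersection. *)
Definition history_cylinders D : set (set Om) :=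
  [set E | exists (J : seq I) (A : I -> set S),
    [/\ uniq J, (forall j, j \in J -> D j), (forall j, measurable (A j)) &
        E = \big[setI/setT]_(j <- J) (X j @^-1` A j)]].

(** The sigma-algebra on [Om] generated by the draws with index in [D]; measurability from
    [history D] expresses dependence on these draws only. *)
Definition history D := g_sigma_algebraType (history_cylinders D).
HB.instance Definition _ D := Measurable.on (history D).

Lemma history_cylindersI D : setI_closed (history_cylinders D).
Proof.
move=> _ _ [J1 [A1 [_ D1 mA1 ->]]] [J2 [A2 [_ D2 mA2 ->]]].
(* A coordinate absent from one of the lists is constrained there by [setT]; [undup] restores
   uniqueness of the indices. *)
exists (undup (J1 ++ J2)), (fun j => (if j \in J1 then A1 j else setT) `&`
   (if j \in J2 then A2 j else setT)); split.
- exact: undup_uniq.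
- by move=> j; rewrite mem_undup mem_cat => /orP[/D1|/D2].
- by move=> j; apply: measurableI; case: ifP.
- rewrite -!bigcap_seq; apply/seteqP; split => w /=.
    by move=> [w1 w2] j _ /=; split; case: ifPn => // jJ; [exact: w1|exact: w2].
  move=> w12; split => j /= jJ.
    by have /= := w12 j; rewrite mem_undup mem_cat jJ => /(_ isT)[].
  by have /= := w12 j; rewrite mem_undup mem_cat jJ orbT => /(_ isT)[].
Qed.

Lemma history_subset D D' : D `<=` D' ->
  history_cylinders D `<=` history_cylinders D'.
Proof.
by move=> DD' _ [J [A [uJ JD mA ->]]]; exists J, A; split => // j /JD /DD'.
Qed.

Lemma measurable_historyS {d' : measure_display} {Y : measurableType d'} D D'
    (h : Om -> Y) : D `<=` D' ->
  measurable_fun setT (h : history D -> Y) -> measurable_fun setT (h : history D' -> Y).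
Proof.
move=> DD' mh mT B mB; have := mh measurableT B mB.
by apply: sub_sigma_algebra2; exact: history_subset.
Qed.

Lemma measurable_history_coord D p : D p ->
  measurable_fun setT (X p : history D -> S).
Proof.
move=> Dp _ B mB; rewrite setTI; apply: sub_sigma_algebra.
exists [:: p], (fun=> B); split => //; first by move=> j; rewrite inE => /eqP ->.
by rewrite big_seq1.
Qed.

Hypothesis mX : forall p, measurable_fun setT (X p).

Lemma history_measurable D (E : set Om) :
  @measurable _ (history D) E -> measurable E.
Proof.
apply: smallest_sub; first exact: sigma_algebra_measurable.
move=> _ [J [A [_ _ mA ->]]]; apply: bigsetI_measurable => j _.
by rewrite -[X in measurable X]setTI; exact: mX.
Qed.

Lemma measurable_of_history {d' : measure_display} {Y : measurableType d'} D
    (h : Om -> Y) : measurable_fun setT (h : history D -> Y) -> measurable_fun setT h.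
Proof.
by move=> mh mT B mB; exact: history_measurable (mh measurableT B mB).
Qed.

Lemma history_independent D p (A : set S) (E : set Om) :
  mutually_independent P X -> ~ D p -> measurable A -> @measurable _ (history D) E ->
  P (X p @^-1` A `&` E) = (P (X p @^-1` A) * P E)%E.
Proof.
move=> indX Dp mA mE.
(* The identity into the coarser [history D] serves as the random variable that carries all draws in
   [D]. *)
have mid : measurable_fun setT (idfun : Om -> history D).
  by move=> _ B mB; rewrite setTI; exact: history_measurable mB.
pose Y : {mfun Om >-> history D} := HB.pack (idfun : Om -> history D)
  (isMeasurableFun.Build _ _ _ _ _ mid).
pose Xp : {mfun Om >-> S} := HB.pack (X p) (isMeasurableFun.Build _ _ _ _ _ (mX p)).
apply: (independent_generated P Xp Y (history_cylinders D) A) => //.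
  exact: history_cylindersI.
move=> _ [J [B [uJ JD mB ->]]] /=.
have pJ : p \notin J by apply/negP => /JD.
(* As [p] is not in [J], mutual independence for [p :: J] and for [J], both with [B'], yields the
   product formula on cylinders. *)
pose B' j := if j == p then A else B j.
have BB' : {in J, forall j, B' j = B j}.
  by move=> j jJ; rewrite /B'; case: eqP => // jp; rewrite -jp jJ in pJ.
have mB' j : measurable (B' j) by rewrite /B'; case: ifP.
have := indX (p :: J) B'; rewrite /= pJ uJ => /(_ isT (fun j _ => mB' j)).
rewrite !big_cons {1 3}/B' eqxx -(indX J B')//.
rewrite (eq_big_seq (fun j => X j @^-1` B j))// => j jJ; by rewrite BB'.
Qed.

Lemma history_tonelli D p (f : S * history D -> \bar R) :
  mutually_independent P X -> ~ D p -> measurable_fun setT f -> (forall z, 0 <= f z)%E ->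
  (\int[P]_w f (X p w, w) = \int[P]_w \int[P]_v f (X p v, w))%E /\
  measurable_fun setT (fun w : Om => \int[P]_v f (X p v, w))%E.
Proof.
move=> indX Dp mf f0.
have mid : measurable_fun setT (idfun : Om -> history D).
  by move=> _ B mB; rewrite setTI; exact: history_measurable mB.
pose Y : {mfun Om >-> history D} := HB.pack (idfun : Om -> history D)
  (isMeasurableFun.Build _ _ _ _ _ mid).
pose Xp : {mfun Om >-> S} := HB.pack (X p) (isMeasurableFun.Build _ _ _ _ _ (mX p)).
split.
  apply: (independent_tonelli P Xp Y f) => // A B mA mB.
  exact: history_independent mB.
apply: (measurable_of_history D).
rewrite (_ : (fun w => _) = fubini_G (distribution P Xp) f).
  exact: measurable_fun_fubini_tonelli_G.
apply/funext => w; rewrite /fubini_G (ge0_integral_distribution Xp (f := fun x => f (x, w)))//.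
by apply: measurableT_comp => //; exact: measurable_pair2.
Qed.

(** [a] and [h] depend only on draws in [D], whereas the seed [p] is fresh. Integrating over this
    seed first freezes both vectors, and [in_Bd_perturb_le] bounds the inner integral pointwise. *)
Lemma compressed_step_le {d : nat} D p (c : S -> 'rV[R]_d -> 'rV[R]_d) (om t : R)
    (a h : Om -> 'rV[R]_d) :
  mutually_independent P X -> ~ D p -> jointly_measurable c ->
  in_Bd P (fun w => c (X p w)) om ->
  coord_measurable (a : history D -> _) -> coord_measurable (h : history D -> _) ->
  (\int[P]_w (sqnorm (a w - t *: (c (X p w) (h w) - h w)))%:E <=
   \int[P]_w (sqnorm (a w) + t ^+ 2 * (om * sqnorm (h w)))%:E)%E.
Proof.
move=> indX Dp mc Bd ma mh.
pose f (z : S * history D) := (sqnorm (a z.2 - t *: (c z.1 (h z.2) - h z.2)))%:E.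
have m2 (k : Om -> 'rV[R]_d) : coord_measurable (k : history D -> _) ->
    coord_measurable (fun z : S * history D => k z.2).
  by move=> mk j; exact: (measurableT_comp (mk j) measurable_snd).
have mf : measurable_fun setT f.
  apply/measurable_EFinP; apply: measurable_sqnorm.
  apply: coord_measurableB; first exact: m2.
  apply: coord_measurableZ; apply: coord_measurableB; last exact: m2.
  by apply: jointly_measurable_comp => //; exact: m2.
have [|-> mF] := history_tonelli D p f indX Dp mf.
  by move=> z; rewrite lee_fin sqnorm_ge0.
apply: ge0_le_integral => //.
- by move=> w _; apply: integral_ge0 => v _; rewrite lee_fin sqnorm_ge0.
- apply/measurable_EFinP; apply: (measurable_of_history D).
  apply: measurable_funD; first exact: measurable_sqnorm.
  apply: measurable_funM; first exact: measurable_cst.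
  apply: measurable_funM; first exact: measurable_cst.
  exact: measurable_sqnorm.
- by move=> w _; exact: (in_Bd_perturb_le P _ om Bd t (a w) (h w)).
Qed.

End History.

(** * Convergence *)

Lemma normr_coord_le {R : realType} {d : nat} (x : 'rV[R]_d) j :
  `|x ord0 j| <= enorm x.
Proof.
rewrite -sqrtr_sqr ler_wsqrtr// /sqnorm /dotv (bigD1 j)//= -expr2 lerDl.
by apply: sumr_ge0 => i _; rewrite -expr2 sqr_ge0.
Qed.

Lemma enorm_le_coord {R : realType} {d : nat} (x : 'rV[R]_d) (e : R) : 0 <= e ->
  (forall j, `|x ord0 j| <= e) -> enorm x <= d%:R * e.
Proof.
move=> e0 xe; rewrite -(@ler_pXn2r _ 2)// ?nnegrE ?enorm_ge0 ?mulr_ge0//.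
rewrite enorm_sqr; apply: (@le_trans _ _ (\sum_(j < d) e ^+ 2)).
  apply: ler_sum => j _; rewrite -expr2 -[leLHS]real_normK ?num_real//.
  by rewrite ler_pXn2r// nnegrE.
rewrite sumr_const card_ord exprMn -[leLHS]mulr_natl ler_wpM2r ?sqr_ge0//.
by rewrite -natrX ler_nat; case: (d) => // k; rewrite expnS expn1 leq_pmulr.
Qed.

(** The topology of row vectors comes from coordinatewise balls, so the Euclidean Lipschitz bound
    has to be converted in both directions. *)
Lemma L_smooth_gradient_continuous {R : realType} {d : nat} (f : 'rV[R]_d -> R)
    (g : 'rV[R]_d -> 'rV[R]_d) (L : R) : L_smooth f g L -> continuous g.
Proof.
move=> [_ gL] x A /nbhs_ballP[e /= e0 eA]; apply/nbhs_ballP.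
(* The added units keep [K] positive when [L] or [d] is zero and make the final inequality
   strict. *)
pose K := (`|L| + 1) * d.+1%:R.
have K0 : 0 < K by rewrite mulr_gt0// ltr_wpDl ?normr_ge0.
exists (e / K) => [|y [eK0 xy]] /=; first exact: divr_gt0.
apply: eA; split => // i j; rewrite ord1 /ball/=.
have -> : g x ord0 j - g y ord0 j = (g x - g y) ord0 j by rewrite !mxE.
apply: le_lt_trans (normr_coord_le _ _) _; apply: le_lt_trans (gL _ _) _.
have : enorm (x - y) <= d%:R * (e / K).
  apply: enorm_le_coord => [|k]; first exact: ltW.
  by rewrite !mxE ltW//; exact: xy.
move=> /(ler_wpM2l (normr_ge0 L)) h; apply: le_lt_trans.
  by apply: le_trans h; rewrite ler_wpM2r ?enorm_ge0 ?ler_norm.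
rewrite !mulrA ltr_pdivrMr// [ltRHS]mulrC ltr_pM2r// /K -natr1.
have := normr_ge0 L; have := ler0n R d; nra.
Qed.

Lemma Tmap_continuous {R : realType} {d : nat} (alpha : R) (xi : 'rV[R]_d) :
  continuous (Tmap alpha xi).
Proof.
move=> x; exact: (cvgD (@scaler_continuous R _ alpha x) (cvg_cst _)).
Qed.

Section Main.
Local Open Scope ereal_scope.
Context {R : realType} {d n : nat}.
Variables (f : 'I_n -> 'rV[R]_d -> R) (g : 'I_n -> 'rV[R]_d -> 'rV[R]_d).
Variables (L alpha om : 'I_n -> R) (xm : 'I_n -> 'rV[R]_d) (xs x0 : 'rV[R]_d).
Variable gamma : R.
Context {dO dS : measure_display} {Om : measurableType dO} {S : measurableType dS}.
Variables (P : probability Om R) (xi : nat -> 'I_n -> Om -> S).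
Variable c : nat -> 'I_n -> S -> 'rV[R]_d -> 'rV[R]_d.
Hypothesis n0 : (0 < n)%N.
Hypothesis fc : forall i, convex_fun (f i).
Hypothesis fgL : forall i, L_smooth (f i) (g i) (L i).
Hypothesis xsmin : is_minimizer (ftilde f alpha xm) xs.
Hypothesis om0 : forall i, (0 <= om i)%R.
Hypothesis mxi : forall k i, measurable_fun setT (xi k i).
Hypothesis mc : forall k i, jointly_measurable (c k i).
Hypothesis indxi : mutually_independent P (fun p : nat * 'I_n => xi p.1 p.2).
Hypothesis cBd : forall k i, in_Bd P (fun w => c k i (xi k i w)) (om i).
Hypothesis gamma0 : (0 < gamma)%R.
Hypothesis gammaA : (gamma <= (4 * (n%:R^-1 * \sum_(i < n) alpha i ^+ 2 * L i
  + 2 * (\big[Num.max/0]_(i < n) (L i * om i * alpha i ^+ 2)) / n%:R))^-1)%R.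

Notation C := (fun k i w => c k i (xi k i w)).
Notation x := (dcgd C g alpha xm gamma x0).
Notation F := (ftilde f alpha xm).
Notation h := (dcgd_grad g alpha xm).
Notation G := (dcgd_mean_grad g alpha xm).
Notation sigma := (2 / (n%:R ^+ 2) *
  \sum_(i < n) om i * alpha i ^+ 2 * sqnorm (g i (Tmap (alpha i) (xm i) xs)))%R.
Notation X := (fun p : nat * 'I_n => xi p.1 p.2).

(** All draws of the rounds before [k], together with those of round [k] whose compressor index is
    in [s]. The iterate [x k] depends on [draws k [::]] only. *)
Definition draws (k : nat) (s : seq 'I_n) : set (nat * 'I_n) :=
  [set p | (p.1 < k)%N \/ p.1 = k /\ p.2 \in s].
Notation hist k s := (history X (draws k s)).

Let mX (p : nat * 'I_n) : measurable_fun setT (X p) := mxi p.1 p.2.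

Lemma dcgd_grad_continuous i : continuous (h i).
Proof.
move=> y; apply: (@continuous_comp _ _ _ (g i \o Tmap (alpha i) (xm i))
  (fun z => alpha i *: z)%R); last exact: scaler_continuous.
apply: (@continuous_comp _ _ _ (Tmap (alpha i) (xm i)) (g i)).
  exact: Tmap_continuous.
exact: (L_smooth_gradient_continuous _ _ _ (fgL i)).
Qed.

Lemma ftilde_continuous : continuous F.
Proof.
move=> y.
suff h : (\sum_(i < n) f i (Tmap (alpha i) (xm i) z))%R @[z --> y] -->
    (\sum_(i < n) f i (Tmap (alpha i) (xm i) y))%R.
  exact: (cvgMl_tmp (a := (n%:R^-1)%R) h).
have FF : Filter (nbhs y) := nbhs_filter y.
apply: cvg_big => [|i _]; first exact: add_continuous.
apply: (@continuous_comp _ _ _ (Tmap (alpha i) (xm i)) (f i)).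
  exact: Tmap_continuous.
by apply: differentiable_continuous; have [/(_ (Tmap (alpha i) (xm i) y))[]] := fgL i.
Qed.

Lemma coord_measurable_hist k s k' s' (u : Om -> 'rV[R]_d) :
  draws k s `<=` draws k' s' -> coord_measurable (u : hist k s -> _) ->
  coord_measurable (u : hist k' s' -> _).
Proof. by move=> kk' mu j; apply: measurable_historyS (mu j). Qed.

Lemma coord_measurable_noise k s s' i (u : Om -> 'rV[R]_d) : i \in s ->
  coord_measurable (u : hist k s' -> _) -> draws k s' `<=` draws k s ->
  coord_measurable ((fun w => C k i w (h i (u w))) : hist k s -> _).
Proof.
move=> si mu ss'; apply: (jointly_measurable_comp (T := hist k s) (c k i) (xi k i)
  (fun w => h i (u w)) (mc k i)).
  exact: (measurable_history_coord X (draws k s) (k, i) (or_intror (conj erefl si))).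
apply: continuous_coord_measurable (dcgd_grad_continuous i) _.
exact: coord_measurable_hist mu.
Qed.

Lemma coord_measurable_dcgd k : coord_measurable (x k : hist k [::] -> _).
Proof.
elim: k => [|k IH]; first exact: coord_measurable_cst.
have sub : draws k (index_enum 'I_n) `<=` draws k.+1 [::].
  by move=> p [pk|[pk _]]; left; [exact: leqW|rewrite pk].
have sub0 : draws k [::] `<=` draws k (index_enum 'I_n) by move=> p [pk|[]//]; left.
apply: coord_measurable_hist sub _; apply: coord_measurableB.
  exact: coord_measurable_hist sub0 IH.
apply: coord_measurableZ; apply: coord_measurable_sum => i _.
exact: (coord_measurable_noise _ _ _ _ _ (mem_index_enum i) IH sub0).
Qed.

Let mOm k s (u : Om -> 'rV[R]_d) : coord_measurable (u : hist k s -> _) ->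
  coord_measurable u.
Proof. by move=> mu j; apply: measurable_of_history (mu j). Qed.

Notation dev k w := (x k w - xs - gamma *: G (x k w))%R.

(** Induction on [s]: the noise already accumulated is absorbed into the vector [a] of
    [compressed_step_le], and the draw [(k, i)] of the new index is fresh. *)
Lemma noise_le k s (t : R) : uniq s ->
  \int[P]_w (sqnorm (dev k w -
      t *: \sum_(i <- s) (C k i w (h i (x k w)) - h i (x k w))))%:E
  <= \int[P]_w (sqnorm (dev k w) +
       t ^+ 2 * \sum_(i <- s) om i * sqnorm (h i (x k w)))%:E.
Proof.
have mx := coord_measurable_dcgd k.
have mh i : coord_measurable ((h i \o x k) : hist k [::] -> _).
  exact: continuous_coord_measurable (dcgd_grad_continuous i) mx.
have ma : coord_measurable ((fun w => dev k w) : hist k [::] -> _).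
  apply: coord_measurableB; first by apply: coord_measurableB => //; exact: coord_measurable_cst.
  by apply: coord_measurableZ; apply: coord_measurableZ; apply: coord_measurable_sum => i _; exact: mh.
elim: s => [_|i s IH /= /andP[si us]].
  under eq_integral do rewrite big_nil scaler0 subr0.
  by under [X in _ <= X]eq_integral do rewrite big_nil mulr0 addr0.
have sub0 : draws k [::] `<=` draws k s by move=> p [pk|[]//]; left.
have mn : coord_measurable ((fun w => dev k w - t *: \sum_(j <- s)
    (C k j w (h j (x k w)) - h j (x k w)))%R : hist k s -> _).
  apply: coord_measurableB; first exact: coord_measurable_hist sub0 ma.
  apply: coord_measurableZ; apply: coord_measurable_sum => j js.
  apply: coord_measurableB; last exact: coord_measurable_hist sub0 (mh j).
  exact: coord_measurable_noise js mx sub0.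
have fresh : ~ draws k s (k, i) by move=> [|[_]]/=; rewrite ?ltnn// (negbTE si).
have := compressed_step_le P X mX (draws k s) (k, i) (c k i) (om i) t
  (fun w => dev k w - t *: \sum_(j <- s) (C k j w (h j (x k w)) - h j (x k w)))%R
  (fun w => h i (x k w)) indxi fresh (mc k i) (cBd k i) mn
  (coord_measurable_hist _ _ _ _ _ sub0 (mh i)).
under eq_integral do rewrite /= -addrA -opprD -scalerDr [X in t *: X]addrC.
under [X in _ <= X -> _]eq_integral do rewrite EFinD.
move=> step; under eq_integral do rewrite big_cons.
(* The bound is split so that the induction hypothesis applies to its first integral, then merged
   again; nonnegativity allows both without integrability. *)
apply: (le_trans step); rewrite ge0_integralD//; last 4 first.
- by move=> w _; rewrite lee_fin sqnorm_ge0.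
- by apply/measurable_EFinP; apply: measurable_sqnorm; exact: mOm mn.
- by move=> w _; rewrite lee_fin mulr_ge0 ?sqr_ge0// mulr_ge0 ?sqnorm_ge0.
- apply/measurable_EFinP; do 2 (apply: measurable_funM; first exact: measurable_cst).
  by apply: measurable_sqnorm; exact: mOm (mh i).
apply: (le_trans (leeD (IH us) (lexx _))).
rewrite -ge0_integralD//; last 4 first.
- move=> w _; rewrite lee_fin addr_ge0 ?sqnorm_ge0// mulr_ge0 ?sqr_ge0//.
  by apply: sumr_ge0 => j _; rewrite mulr_ge0 ?sqnorm_ge0.
- apply/measurable_EFinP; apply: measurable_funD.
    by apply: measurable_sqnorm; exact: mOm ma.
  apply: measurable_funM; first exact: measurable_cst.
  apply: measurable_sum => j; apply: measurable_funM; first exact: measurable_cst.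
  by apply: measurable_sqnorm; exact: mOm (mh j).
- by move=> w _; rewrite lee_fin mulr_ge0 ?sqr_ge0// mulr_ge0 ?sqnorm_ge0.
- apply/measurable_EFinP; do 2 (apply: measurable_funM; first exact: measurable_cst).
  by apply: measurable_sqnorm; exact: mOm (mh i).
rewrite le_eqVlt; apply/orP; left; apply/eqP; apply: eq_integral => w _.
by rewrite -EFinD big_cons; congr EFin; ring.
Qed.

Lemma ftilde_gap_ge0 y : (0 <= F y - F xs)%R.
Proof. by rewrite subr_ge0; exact: xsmin. Qed.

Lemma measurable_ftilde_gap (u : Om -> 'rV[R]_d) : coord_measurable u ->
  measurable_fun setT (fun w => F (u w) - F xs)%R.
Proof.
move=> mu; apply: measurable_funB; last exact: measurable_cst.
exact: continuous_fun_measurable ftilde_continuous mu.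
Qed.

(** The gap stays on the left-hand side, so that only nonnegative integrals are added and none has
    to be known finite. *)
Lemma dcgd_expected_step k :
  \int[P]_w (sqnorm (x k.+1 w - xs))%:E + \int[P]_w (gamma * (F (x k w) - F xs))%:E
  <= \int[P]_w (sqnorm (x k w - xs))%:E + (gamma ^+ 2 * sigma)%:E.
Proof.
have mx : coord_measurable (x k) := mOm _ _ _ (coord_measurable_dcgd k).
have mh i : coord_measurable (h i \o x k).
  exact: continuous_coord_measurable (dcgd_grad_continuous i) mx.
have n_neq0 : (n%:R : R)%R != 0%R by rewrite pnatr_eq0 -lt0n.
(* The update is the exact gradient step, which gives [dev], perturbed by the centred compression
   errors. *)
have xE w : (x k.+1 w - xs = dev k w - (gamma / n%:R) *:
    \sum_(i < n) (C k i w (h i (x k w)) - h i (x k w)))%R.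
  rewrite sumrB scalerBr /dcgd_mean_grad scalerA /= opprB addrA subrK.
  by rewrite addrAC.
under eq_integral do rewrite xE.
apply: (le_trans (leeD (noise_le k _ (gamma / n%:R)%R (index_enum_uniq _)) (lexx _))).
have mdev : measurable_fun setT (fun w => sqnorm (dev k w) + (gamma / n%:R) ^+ 2 *
    \sum_(i < n) om i * sqnorm (h i (x k w)))%R.
  apply: measurable_funD.
    apply: measurable_sqnorm; apply: coord_measurableB.
      by apply: coord_measurableB => //; exact: coord_measurable_cst.
    apply: coord_measurableZ; apply: coord_measurableZ.
    by apply: coord_measurable_sum => i _; exact: mh.
  apply: measurable_funM; first exact: measurable_cst.
  apply: measurable_sum => i; apply: measurable_funM; first exact: measurable_cst.
  exact: measurable_sqnorm (mh i).
have mgap : measurable_fun setT (fun w => gamma * (F (x k w) - F xs))%R.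
  by apply: measurable_funM; [exact: measurable_cst|exact: measurable_ftilde_gap].
have mdist : measurable_fun setT (fun w => sqnorm (x k w - xs))%R.
  by apply: measurable_sqnorm; apply: coord_measurableB => //; exact: coord_measurable_cst.
have dev0 w : (0 <= sqnorm (dev k w) + (gamma / n%:R) ^+ 2 *
    \sum_(i < n) om i * sqnorm (h i (x k w)))%R.
  rewrite addr_ge0 ?sqnorm_ge0// mulr_ge0 ?sqr_ge0//.
  by apply: sumr_ge0 => i _; rewrite mulr_ge0 ?sqnorm_ge0.
have gap0 w : (0 <= gamma * (F (x k w) - F xs))%R.
  by rewrite mulr_ge0 ?ftilde_gap_ge0// ltW.
have sigma0 : (0 <= gamma ^+ 2 * sigma)%R.
  rewrite mulr_ge0 ?sqr_ge0// mulr_ge0 ?divr_ge0 ?exprn_ge0//.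
  by apply: sumr_ge0 => i _; rewrite mulr_ge0 ?sqnorm_ge0// mulr_ge0 ?sqr_ge0.
rewrite -ge0_integralD//; last 4 first.
- by move=> w _; rewrite lee_fin.
- exact/measurable_EFinP.
- by move=> w _; rewrite lee_fin.
- exact/measurable_EFinP.
have <- : \int[P]_w (gamma ^+ 2 * sigma)%:E = (gamma ^+ 2 * sigma)%:E.
  by rewrite integral_cst//= probability_setT mule1.
rewrite -ge0_integralD//; last 2 first.
- by move=> w _; rewrite lee_fin sqnorm_ge0.
- exact/measurable_EFinP.
apply: ge0_le_integral => //.
- by move=> w _; rewrite -EFinD lee_fin addr_ge0.
- by apply: emeasurable_funD; exact/measurable_EFinP.
- by apply: emeasurable_funD; [exact/measurable_EFinP|exact: measurable_cst].
- move=> w _; rewrite -!EFinD lee_fin.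
  exact: (dcgd_step f g L alpha om xm xs n0 fc fgL xsmin om0).
Qed.

Lemma dcgd_telescope k :
  \int[P]_w (sqnorm (x k w - xs))%:E +
    \sum_(0 <= j < k) \int[P]_w (gamma * (F (x j w) - F xs))%:E
  <= (sqnorm (x0 - xs) + k%:R * (gamma ^+ 2 * sigma))%:E.
Proof.
elim: k => [|k IH].
  by rewrite /= big_nil adde0 mul0r addr0 integral_cst//= probability_setT mule1.
rewrite big_nat_recr//= addeCA addeC.
apply: (le_trans (leeD (dcgd_expected_step k) (lexx _))).
rewrite addeAC; apply: (le_trans (leeD IH (lexx _))).
by rewrite -EFinD lee_fin -addrA -[X in (_ * _ + X)%R]mul1r -mulrDl natr1.
Qed.

Lemma dcgd_mean_bound k : (0 < k)%N ->
  \int[P]_w (F (xbar x k w) - F xs)%:E <=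
  ((gamma * k%:R)^-1 * (sqnorm (x0 - xs) + k.+1%:R * (gamma ^+ 2 * sigma)))%:E.
Proof.
move=> k0; have gk0 : (0 < gamma * k%:R)%R by rewrite mulr_gt0 ?ltr0n.
have mx j : coord_measurable (x j) := mOm _ _ _ (coord_measurable_dcgd j).
have gap0 j w : (0 <= gamma * (F (x j w) - F xs))%R.
  by rewrite mulr_ge0 ?ftilde_gap_ge0// ltW.
have mgap j : measurable_fun setT (fun w => (gamma * (F (x j w) - F xs))%:E).
  apply/measurable_EFinP; apply: measurable_funM; first exact: measurable_cst.
  exact: measurable_ftilde_gap.
have mxbar : coord_measurable (xbar x k).
  by apply: coord_measurableZ; apply: coord_measurable_sum => j _.
have mgbar : measurable_fun setT (fun w => (F (xbar x k w) - F xs)%:E).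
  by apply/measurable_EFinP; exact: measurable_ftilde_gap.
rewrite EFinM lee_pdivlMl// -ge0_integralZl_EFin ?(ltW gk0)//; last first.
  by move=> w _; rewrite lee_fin ftilde_gap_ge0.
apply: (@le_trans _ _ (\int[P]_w \sum_(1 <= j < k.+1) (gamma * (F (x j w) - F xs))%:E)).
  apply: ge0_le_integral => //.
  - by move=> w _; rewrite -EFinM lee_fin mulr_ge0 ?ftilde_gap_ge0// ltW.
  - exact: measurable_funeM.
  - by apply: emeasurable_sum => j; exact: mgap.
  move=> w _; rewrite -EFinM sumEFin lee_fin -mulr_sumr -mulrA ler_pM2l//.
  rewrite sumrB mulrBr sumr_const_nat subn1/= -[X in (_ <= _ - X)%R]mulr_natl lerD2r.
  exact: convex_funM_mean (ftilde_convex f alpha xm n0 fc) k0.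
rewrite ge0_integral_sum//; last by move=> j w _; rewrite lee_fin.
(* The mean runs over iterates 1 to [k], which takes the rounds 0 to [k], hence [k.+1]; the final
   distance and the gap at index 0 are dropped. *)
apply: le_trans (dcgd_telescope k.+1); apply: lee_paddl.
  by apply: integral_ge0 => w _; rewrite lee_fin sqnorm_ge0.
rewrite [leRHS]big_nat_recl//= [leLHS]big_add1/= leeDr//.
by apply: integral_ge0 => w _; rewrite lee_fin; exact: (gap0 0%N w).
Qed.

End Main.

Theorem theorem5 (R : realType) (d n : nat)
    (f : 'I_n -> 'rV[R]_d -> R) (g : 'I_n -> 'rV[R]_d -> 'rV[R]_d)
    (L : 'I_n -> R) (xm : 'I_n -> 'rV[R]_d) (alpha om : 'I_n -> R)
    (xs x0 : 'rV[R]_d) (gamma : R)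
    (dO : measure_display) (Om : measurableType dO) (P : probability Om R)
    (dS : measure_display) (S : measurableType dS)
    (xi : nat -> 'I_n -> Om -> S)
    (c : nat -> 'I_n -> S -> 'rV[R]_d -> 'rV[R]_d) :
  (0 < n)%N ->
  (forall i, convex_fun (f i)) ->
  (forall i, L_smooth (f i) (g i) (L i)) ->
  (forall i, is_minimizer (f i) (xm i)) ->
  (forall i, 0 < alpha i < 1) ->
  is_minimizer (ftilde f alpha xm) xs ->
  (forall i, 0 <= om i) ->
  (* C_i^k(w) = c k i (xi k i w): random operators drawn independently *)
  (forall k i, measurable_fun setT (xi k i)) ->
  (forall k i, jointly_measurable (c k i)) ->
  mutually_independent P (fun p : nat * 'I_n => xi p.1 p.2) ->
  (forall k i, in_Bd P (fun w => c k i (xi k i w)) (om i)) ->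
  0 < gamma ->
  gamma <= (4 * (n%:R^-1 * \sum_(i < n) alpha i ^+ 2 * L i
                 + 2 * (\big[Num.max/0]_(i < n) (L i * om i * alpha i ^+ 2)) / n%:R))^-1 ->
  let C := fun k i w => c k i (xi k i w) in
  let x := dcgd C g alpha xm gamma x0 in
  let ft := ftilde f alpha xm in
  let sigma := 2 / (n%:R ^+ 2) *
      \sum_(i < n) om i * alpha i ^+ 2 * sqnorm (g i (Tmap (alpha i) (xm i) xs)) in
  forall k : nat, (0 < k)%N ->
    (\int[P]_w ((ft (xbar x k w) - ft xs)%:E) <=
      (2 * (ft x0 - ft xs) / k%:R + sqnorm (x0 - xs) / (gamma * k%:R)
       + 2 * gamma * sigma)%:E)%E.
Proof.
move=> n0 fc fgL _ _ xsmin om0 mxi mc indxi cBd gamma0 gammaA C x ft sigma k k0.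
apply: le_trans (dcgd_mean_bound f g L alpha om xm xs x0 gamma P xi c n0 fc fgL
  xsmin om0 mxi mc indxi cBd gamma0 gammaA k k0) _.
have sigma0 : 0 <= sigma.
  rewrite mulr_ge0 ?divr_ge0 ?exprn_ge0//.
  by apply: sumr_ge0 => i _; rewrite mulr_ge0 ?sqnorm_ge0// mulr_ge0 ?sqr_ge0.
have ft0 : 0 <= 2 * (ft x0 - ft xs) / k%:R.
  by rewrite divr_ge0 ?mulr_ge0// subr_ge0; exact: xsmin.
have k_gt0 : 0 < (k%:R : R) by rewrite ltr0n.
rewrite lee_fin mulrDr (mulrC _ (sqnorm _)) -/sigma -[leLHS]add0r addrA.
rewrite lerD// ?lerD2r//.
have -> : (gamma * k%:R)^-1 * (k.+1%:R * (gamma ^+ 2 * sigma)) =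
    gamma * sigma * (k.+1%:R / k%:R).
  by field; rewrite !gt_eqF.
(* The factor 2 in front of [gamma * sigma] comes from [k.+1 <= 2 * k], valid as [k] is positive. *)
rewrite -[leRHS]mulrA [leRHS]mulrC ler_wpM2l ?(mulr_ge0 (ltW gamma0) sigma0)//.
by rewrite ler_pdivrMr// -natrM ler_nat mul2n -addnn -addn1 leq_add2l.
Qed.
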